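(* Let $\{Y(u,n):u\in\mathcal U,\ n\in\mathbb N\}$ be a family of independent Hermitian random matrices, $Y(u,n)$ being of size $n\times n$, whose asymptotic joint distribution under $\tau(n)$ agrees with that of the family $\{\gamma(u):u\in\mathcal U\}$ under $\Psi=\sum_{q}d_q\Psi_q$ and which is asymptotically free from $\{D_1,\dots,D_r\}$ (under $\tau(n)$). If $\|Y(u,n)\|\le C$ for all $n,u$ and some constant $C$, then $$\lim_{n\to\infty}\tau_q(n)\big(T_{p_1,q_1}(u_1,n)\cdots T_{p_m,q_m}(u_m,n)\big)=\Psi_q\big(\widehat\gamma_{p_1,q_1}(u_1)\cdots\widehat\gamma_{p_m,q_m}(u_m)\big)$$ for any $m\in\mathbb N$, $u_1,\dots,u_m\in\mathcal U$ and $p_1,q_1,\dots,p_m,q_m,q\in[r]$.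
   Context: Random matrices. Fix $r\in\mathbb N$, $[r]=\{1,\dots,r\}$, and a finite index set $\mathcal U$. For each $n$ let $[n]=\{1,\dots,n\}$ be partitioned into disjoint nonempty intervals $N_1,\dots,N_r$ (depending on $n$), $n_q=|N_q|$, and assume $\lim_{n\to\infty}n_q/n=d_q\ge 0$ for each $q$ (so $\sum_q d_q=1$; some $d_q$ may be $0$). $D_q$ is the $n\times n$ diagonal matrix with $(D_q)_{j,j}=1$ if $j\in N_q$ and all other entries $0$. Random matrices have entries in $L=\bigcap_{1\le p<\infty}L^p$ of a probability space; $\mathbb E$ is expectation, $\|\cdot\|$ the operator norm. $\tau(n)=\mathbb E\otimes\mathrm{tr}(n)$, where $\mathrm{tr}(n)(A)=\frac1n\sum_{j=1}^n A_{j,j}$, and $\tau_q(n)(A)=\frac1{n_q}\mathbb E\sum_{j\in N_q}A_{j,j}$ (partial trace). The symmetric blocks are $T_{q,q}(u,n)=D_qY(u,n)D_q$ and $T_{p,q}(u,n)=D_pY(u,n)D_q+D_qY(u,n)D_p$ for $p\ne q$. ''Asymptotic joint distribution agrees'' means that all mixed moments of the $Y(u,n)$ under $\tau(n)$ converge to the corresponding mixed moments of the $\gamma(u)$ under $\Psi$; ''asymptotically free from $\{D_1,\dots,D_r\}$'' means that the joint moments of the two families under $\tau(n)$ converge to those of two families that are free. Operators. $\mathcal M$ is the Hilbert space with orthonormal basis consisting of vacuum vectors $\Omega_1,\dots,\Omega_r$ and all simple tensors $e_{p_1,p_2}(u_1)\otimes e_{p_2,p_3}(u_2)\otimes\cdots\otimes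 e_{p_m,q}(u_m)$ with $m\ge1$, $p_1,\dots,p_m,q\in[r]$, $u_1,\dots,u_m\in\mathcal U$. Put $\Psi_q(a)=\langle a\Omega_q,\Omega_q\rangle$ and $\Psi=\sum_q d_q\Psi_q$. The matricially free creation operators $\wp_{p,q}(u)$ with covariance $d_p$ are the bounded operators given by $\wp_{p,q}(u)\Omega_q=\sqrt{d_p}\,e_{p,q}(u)$, $\wp_{p,q}(u)(e_{q,s}(t)\otimes w)=\sqrt{d_p}\,e_{p,q}(u)\otimes e_{q,s}(t)\otimes w$ for every basis vector $e_{q,s}(t)\otimes w$, and zero on all other basis vectors. Put $\wp(u)=\sum_{p,q=1}^r\wp_{p,q}(u)$. $P_q$ is the orthogonal projection onto the closed span of $\Omega_q$ and all simple tensors whose first factor is of the form $e_{q,s}(t)$. Let $(r_k(u))_{k\ge1}$, $u\in\mathcal U$, be sequences of real numbers (the free cumulants of probability measures $\mu(u)$ on $\mathbb R$). The canonical noncommutative random variables are $\gamma(u)=\wp(u)^*+\sum_{k=0}^\infty r_{k+1}(u)\wp(u)^k$. For $p,q\in[r]$, $$\gamma_{p,q}(u)=P_q\wp(u)^*P_p+\sum_{k=0}^\infty r_{k+1}(u)P_p\wp(u)^kP_q,$$ and $\widehat\gamma_{q,q}(u)=\gamma_{q,q}(u)=P_q\gamma(u)P_q$, $\widehat\gamma_{p,q}(u)=\gamma_{p,q}(u)+\gamma_{q,p}(u)=P_p\gamma(u)P_q+P_q\gamma(u)P_p$ for $p\ne q$. If the series do not define bounded operators, a mixed moment of order $m$ is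 understood as the one obtained by truncating every series at some $k\le N$ with $N\ge m$ (the value does not depend on such $N$).
   Formalization: The limit is stated only for partial traces τ_q with d_q>0 (other d_p may vanish); for d_q=0 the claim fails, e.g. r=2, N_2={n}, Y(n)=D_2, all r_k=0: τ_2(T_{2,2})=1 but Ψ_2(γ_{2,2})=0. *)

(* Defs.v *)
From HB Require Import structures.
From mathcomp Require Import all_boot all_order all_algebra.
From mathcomp Require Import all_classical all_reals all_analysis.
From mathcomp Require Import complex.
Set Implicit Arguments.
Unset Strict Implicit.
Unset Printing Implicit Defensive.
Import Order.TTheory GRing.Theory Num.Theory numFieldNormedType.Exports.
Local Open Scope classical_set_scope.
Local Open Scope ring_scope.
Local Open Scope complex_scope.

(* [R[i]] itself does not display its topology; the topological instances are
   attached to the carrier of an abstract [numFieldType]. *)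
Notation Cplx R := (Num.NumField.sort (R[i] : numFieldType)).

Definition ccvg (R : realType) (z : nat -> R[i]) (l : R[i]) : Prop :=
  ((z : nat -> Cplx R) @ \oo --> (l : Cplx R)).

(* ------------------------------------------------------------------------ *)
Section RandomMatrices.
Context {R : realType} {disp : measure_display} {Omega : measurableType disp}.
Variable P : probability Omega R.
Local Notation C := R[i].

Definition cexpectation (f : Omega -> C) : C :=
  fine 'E_P[fun x => complex.Re (f x)] +i* fine 'E_P[fun x => complex.Im (f x)].

(* [Lfun P p] consists of the measurable real functions with finite p-norm;
   a complex function is in L^p iff its real and imaginary parts are. *)
Definition in_Linfty_minus (f : Omega -> C) : Prop :=
  forall p : R, 1 <= p ->
    ((fun x => complex.Re (f x)) \in Lfun P p%:E) /\
    ((fun x => complex.Im (f x)) \in Lfun P p%:E).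

Definition tau n (A : Omega -> 'M[C]_n) : C :=
  cexpectation (fun x => n%:R^-1 * \tr (A x)).

(* As #|Nq| / n * ptau Nq A is the value of tau at D_q A, limits under tau
   determine limits under ptau when #|Nq| / n has a positive limit, and give
   no information on them when #|Nq| / n tends to 0. *)
Definition ptau n (Nq : {set 'I_n}) (A : Omega -> 'M[C]_n) : C :=
  #|Nq|%:R^-1 * cexpectation (fun x => \sum_(j in Nq) A x j j).

Definition sigma_mx n (Y : Omega -> 'M[C]_n) : set (set Omega) :=
  <<s [set E | exists i j (B : set R), measurable B /\
        (E = (fun x => complex.Re (Y x i j)) @^-1` B \/
         E = (fun x => complex.Im (Y x i j)) @^-1` B)] >>.

Definition independent_mx (U : finType) n (Y : U -> Omega -> 'M[C]_n) : Prop :=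
  forall (J : {set U}) (E : U -> set Omega),
    (forall u, u \in J -> sigma_mx (Y u) (E u)) ->
    P (\bigcap_(u in [set` J]) E u) = (\prod_(u in J) P (E u))%E.

Definition hermitian_mx n (A : 'M[C]_n) : Prop :=
  forall i j, A i j = (A j i)^*%C.

Definition l2norm n (v : 'cV[C]_n) : R :=
  Num.sqrt (\sum_(i < n) complex.Re (`|v i 0| ^+ 2)).

Definition opnorm n (A : 'M[C]_n) : R :=
  sup [set l2norm (A *m v) | v in [set v : 'cV[C]_n | l2norm v <= 1]].

Definition is_interval n (S : {set 'I_n}) : Prop :=
  forall i j k : 'I_n, i \in S -> k \in S -> (i <= j <= k)%N -> j \in S.

Definition interval_partition n r (N : 'I_r -> {set 'I_n}) : Prop :=
  [/\ forall q, (0 < #|N q|)%N,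
      forall p q, p != q -> N p :&: N q = finset.set0,
      forall j, exists q, j \in N q
    & forall q, is_interval (N q)].

Definition blockD n (S : {set 'I_n}) : 'M[C]_n :=
  diag_mx (\row_j (j \in S)%:R).

Definition symblock n r (N : 'I_r -> {set 'I_n}) (p q : 'I_r) (A : 'M[C]_n) :
    'M[C]_n :=
  if p == q then blockD (N q) *m A *m blockD (N q)
  else blockD (N p) *m A *m blockD (N q) + blockD (N q) *m A *m blockD (N p).

End RandomMatrices.

(* ------------------------------------------------------------------------ *)
Section Freeness.
Context {R : realType} {A : algType R[i]}.

Inductive gen_subalg (S : set A) : set A :=
| gen_one : gen_subalg S 1
| gen_base a : S a -> gen_subalg S a
| gen_lin (z : R[i]) a b :
    gen_subalg S a -> gen_subalg S b -> gen_subalg S (z *: a + b)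
| gen_mul a b : gen_subalg S a -> gen_subalg S b -> gen_subalg S (a * b).

Definition free_subalgs (phi : A -> R[i]) (I : Type) (B : I -> set A) : Prop :=
  forall (m : nat) (i : nat -> I) (a : nat -> A),
    (0 < m)%N ->
    (forall k, (k < m)%N -> B (i k) (a k) /\ phi (a k) = 0) ->
    (forall k, (k.+1 < m)%N -> i k <> i k.+1) ->
    phi (\prod_(k < m) a k) = 0.

Definition free_families (phi : A -> R[i]) (I J : Type) (y : I -> A)
    (z : J -> A) : Prop :=
  free_subalgs phi
    (fun b : bool => gen_subalg (if b then range y else range z)).

End Freeness.

(* The joint moments of the two families of random matrices converge to those
   of two families that are free in some noncommutative probability space. *)
Definition asymptotically_free (R : realType) (disp : measure_display)
    (Omega : measurableType disp) (P : probability Omega R) (I J : Type)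
    (Y : I -> forall n, Omega -> 'M[R[i]]_n)
    (Z : J -> forall n, Omega -> 'M[R[i]]_n) : Prop :=
  exists (A : algType R[i]) (phi : {scalar A}) (y : I -> A) (z : J -> A),
    [/\ phi 1 = 1,
        free_families phi y z
      & forall (m : nat) (l : 'I_m -> I + J),
          ccvg (fun n => tau P (fun x =>
                  \prod_(k < m) match l k with
                                | inl i => Y i n x
                                | inr j => Z j n x
                                end))
               (phi (\prod_(k < m) match l k with
                                   | inl i => y i
                                   | inr j => z j
                                   end))].

(* ------------------------------------------------------------------------ *)
(* The orthonormal basis.  The pair [([:: (p1, u1); ...; (pm, um)], q)] stands
   for e_{p1,p2}(u1) (x) e_{p2,p3}(u2) (x) ... (x) e_{pm,q}(um), and
   [([::], q)] for the vacuum vector Omega_q. *)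
Definition fock_basis (r : nat) (U : finType) : countType :=
  (seq ('I_r * U) * 'I_r)%type.

Section Fock.
Context {R : realType} {r : nat} {U : finType}.
Local Notation C := R[i].
Local Notation basis := (fock_basis r U).

(* The first index of a basis vector: q for Omega_q, and p1 for a simple
   tensor starting with e_{p1,p2}(u1). *)
Definition first_index (b : basis) : 'I_r := head b.2 (map fst b.1).

(* Vectors are given by their coordinates in the orthonormal basis; the Hilbert
   space consists of the square-summable ones.  The operators below are
   everywhere-defined maps whose restrictions to it are bounded. *)
Definition vec : Type := basis -> C.
Definition op : Type := vec -> vec.

Definition ket (b : basis) : vec := fun b' => (b' == b)%:R.

(* The sum over the basis, enumerated by [pickle_inv] (each basis vector occurs
   once); it converges absolutely on square-summable vectors. *)
Definition inner (x y : vec) : C :=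
  lim (series (fun k => match pickle_inv k with
                        | Some b => (x b * (y b)^*%C : Cplx R)
                        | None => 0
                        end) @ \oo).

(* The adjoint of a bounded operator: <A^* x, b> = <x, A b>. *)
Definition adj (A : op) : op := fun x b => inner x (A (ket b)).

Definition op_add (A B : op) : op := fun x b => A x b + B x b.
Definition op_zero : op := fun _ _ => 0.
Definition op_scale (c : C) (A : op) : op := fun x b => c * A x b.
Definition op_pow (A : op) (k : nat) : op := fun x => iter k A x.

Definition vacuum (q : 'I_r) : vec := ket ([::], q).
Definition Psi_at (q : 'I_r) (A : op) : C := inner (A (vacuum q)) (vacuum q).
Definition Psi (d : 'I_r -> R) (A : op) : C :=
  \sum_(q < r) (d q)%:C * Psi_at q A.

(* Written in coordinates; see [creation_ket]. *)
Definition creation (d : 'I_r -> R) (p q : 'I_r) (u : U) : op :=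
  fun x b =>
    if b is ((p', u') :: w, s) then
      if [&& p' == p, u' == u & first_index (w, s) == q]
      then (Num.sqrt (d p))%:C * x (w, s) else 0
    else 0.

Lemma creation_ket d p q u (w : seq ('I_r * U)) (s : 'I_r) :
  creation d p q u (ket (w, s)) =
  if first_index (w, s) == q
  then fun b => (Num.sqrt (d p))%:C * ket ((p, u) :: w, s) b
  else fun=> 0.
Proof.
apply/funext => -[[|[p' u'] w'] s'] /=.
  by rewrite /ket; case: ifP => // _; rewrite xpair_eqE /= mulr0.
have eK : ket ((p, u) :: w, s) ((p', u') :: w', s') =
    [&& p' == p, u' == u & (w', s') == (w, s)]%:R :> C.
  by rewrite /ket; congr (_%:R); rewrite !xpair_eqE /= -!andbA.
rewrite (fun_if (fun f : vec => f _)) eK.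
have [?|ne] := eqVneq p' p; last by rewrite /= mulr0 if_same.
have [?|ne] := eqVneq u' u; last by rewrite /= mulr0 if_same.
have [[-> ->]|ne] := eqVneq (w', s') (w, s); first by rewrite /ket eqxx.
by rewrite /ket (negbTE ne) !mulr0 !if_same.
Qed.

Definition wp (d : 'I_r -> R) (u : U) : op :=
  \big[op_add/op_zero]_(p < r) \big[op_add/op_zero]_(q < r) creation d p q u.

Definition proj (q : 'I_r) : op :=
  fun x b => if first_index b == q then x b else 0.

(* [kappa u k] is the k-th cumulant r_k(u), k >= 1; [kappa u 0] is not used.
   The series are truncated at k <= N.  A moment of order m only involves the
   terms with k < m, so its value is the same for all N >= m, and it is the
   moment of the full series whenever these define bounded operators. *)
Definition gamma (d : 'I_r -> R) (kappa : U -> nat -> R) (N : nat) (u : U) :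
    op :=
  op_add (adj (wp d u))
    (\big[op_add/op_zero]_(k < N.+1)
       op_scale (kappa u k.+1)%:C (op_pow (wp d u) k)).

Definition gamma_blk d (kappa : U -> nat -> R) N (p q : 'I_r) (u : U) : op :=
  op_add (proj q \o adj (wp d u) \o proj p)
    (\big[op_add/op_zero]_(k < N.+1)
       op_scale (kappa u k.+1)%:C (proj p \o op_pow (wp d u) k \o proj q)).

Definition gamma_hat d kappa N (p q : 'I_r) (u : U) : op :=
  if p == q then gamma_blk d kappa N q q u
  else op_add (gamma_blk d kappa N p q u) (gamma_blk d kappa N q p u).

Definition op_prod (m : nat) (A : 'I_m -> op) : op :=
  \big[(fun B D : op => B \o D)/idfun]_(k < m) A k.

End Fock.

(* Main.v *)
(* Since [Psi (P_q a) = d_q Psi_q a] and the same relation holds asymptotically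
    between [tau_q(n)] and [tau(n)], the theorem says that the limits of the joint
    moments of the [Y(u,n)] and the [D_q] are the joint moments of the [gamma(u)]
    and the [P_q] under [Psi].  The marginal moments agree, the former families are
    asymptotically free, and joint moments of free families are determined by the
    marginal ones; so it remains to show that [{gamma(u)}] and [{P_q}] are free
    under [Psi].  This rests on the relation
    [wp(u)^* f wp(v) = delta_{u,v} Psi(f) 1] for [f] in the span of the [P_q]: a
    product of centered elements alternating between the two algebras, applied to
    a vacuum vector, has no vacuum component. *)

Require Import Defs.
From HB Require Import structures.
From mathcomp Require Import all_boot all_order all_algebra.
From mathcomp Require Import all_classical all_reals all_analysis.
From mathcomp Require Import measurable_realfun complex.
Set Implicit Arguments.
Unset Strict Implicit.
Unset Printing Implicit Defensive.
Import Order.TTheory GRing.Theory Num.Theory numFieldNormedType.Exports.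
Local Open Scope classical_set_scope.
Local Open Scope ring_scope.

(** * Operators on the Fock space in coordinates *)

Section FockSpace.
Context {R : realType} {r : nat} {U : finType}.
Variables (d : 'I_r -> R) (kappa : U -> nat -> R).
Local Notation C := R[i].
Local Notation basis := (fock_basis r U).
Local Notation vec := (@vec R r U).
Local Notation op := (@op R r U).
Local Notation wp := (@wp R r U d).
Local Notation "'sq' p" := ((Num.sqrt (d p))%:C)%C (at level 10, p at level 9).

(** The second vector has finite support, so the partial sums of the series are constant once they
    pass the largest code [pickle (e i)]. The family [e] may have repetitions. *)
Lemma inner_ket_sum (I : finType) (x : vec) (c : I -> C) (e : I -> basis) :
  inner x (fun b => \sum_i c i * ket (e i) b) = \sum_i x (e i) * (c i)^*%C.
Proof.
rewrite /inner; apply: (@lim_near_cst (Cplx R)); first exact: norm_hausdorff.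
near=> n; rewrite /series /=.
have -> : \sum_i x (e i) * (c i)^*%C =
    \sum_i \sum_(0 <= k < n) (if k == pickle (e i) then x (e i) * (c i)^*%C else 0).
  apply: eq_bigr => i _; rewrite -big_mkcond big_mkord.
  have lt : (pickle (e i) < n)%N.
    apply: (@leq_trans (\max_i (pickle (e i)).+1)).
      exact: (leq_bigmax_cond (F := fun i => (pickle (e i)).+1)).
    by near: n; exact: nbhs_infty_ge.
  rewrite (eq_bigl (pred1 (Ordinal lt))) ?big_pred1_eq//.
rewrite exchange_big /=; apply: eq_bigr => k _.
case E: (pickle_inv k) => [b|].
  have kE : k = pickle b.
    by have := @pickle_invK basis k; rewrite /= E.
  rewrite rmorph_sum mulr_sumr; apply: eq_bigr => i _.
  have -> : (k == pickle (e i)) = (e i == b).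
    apply/eqP/eqP => [kE'|->//]; apply: (pcan_inj pickleK_inv).
    by rewrite -kE -kE'.
  rewrite rmorphM /ket eq_sym; case: eqVneq => [->|_].
    by rewrite rmorph1 mulr1.
  by rewrite rmorph0 !mulr0.
rewrite big1// => i _; case: eqP => // kE.
by rewrite kE pickleK_inv in E.
Unshelve. all: by end_near. Qed.

Lemma inner_ket (x : vec) (b : basis) : inner x (ket b) = x b.
Proof.
have -> : ket b = (fun b' => \sum_(i < 1) 1 * ket b b') :> vec.
  by apply/funext => b'; rewrite big_ord1 mul1r.
by rewrite (@inner_ket_sum 'I_1 x (fun=> 1) (fun=> b)) big_ord1 rmorph1 mulr1.
Qed.

Lemma Psi_atE (q : 'I_r) (A : op) : Psi_at q A = A (vacuum q) ([::], q).
Proof. exact: inner_ket. Qed.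

Lemma PsiE (A : op) :
  Psi d A = \sum_q (d q)%:C%C * A (vacuum q) ([::], q).
Proof. by apply: eq_bigr => q _; rewrite Psi_atE. Qed.

Lemma op_sumE (I : Type) (s : seq I) (F : I -> op) (x : vec) (b : basis) :
  (\big[op_add/op_zero]_(i <- s) F i) x b = \sum_(i <- s) F i x b.
Proof. exact: (big_morph (fun A : op => A x b)). Qed.

Lemma wpE (u : U) (x : vec) (b : basis) :
  wp u x b = if b is ((p, v) :: w, s)
             then if v == u then sq p * x (w, s) else 0 else 0.
Proof.
rewrite /Defs.wp op_sumE; case: b => [[|[p v] w] s].
  by rewrite big1// => p _; rewrite op_sumE big1.
rewrite (bigD1 p)//= [X in _ + X]big1 ?addr0; last first.
  move=> p' /negbTE; rewrite eq_sym => np; rewrite op_sumE big1// => q _.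
  by rewrite /creation np.
rewrite op_sumE (bigD1 (first_index (w, s)))//= [X in _ + X]big1 ?addr0.
  by rewrite /creation !eqxx /= andbT; case: ifP.
move=> q /negbTE; rewrite eq_sym => nq.
by rewrite /creation nq !andbF.
Qed.

Definition annihilation (u : U) : op :=
  fun x b => \sum_p sq p * x ((p, u) :: b.1, b.2).

(** [wp u] sends a basis vector to a finite combination of basis vectors, so pairing with it is a
    finite sum and the formula holds for every vector, square-summable or not. *)
Lemma adj_wpE (u : U) : adj (wp u) = annihilation u.
Proof.
apply/funext => x; apply/funext => -[w s]; rewrite /adj /annihilation /=.
have -> : wp u (ket (w, s)) =
    (fun b => \sum_p sq p * ket ((p, u) :: w, s) b) :> vec.
  apply/funext => b; rewrite wpE; case: b => [[|[p v] w'] s'].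
    by rewrite big1// => p _; rewrite /ket xpair_eqE mulr0.
  rewrite (bigD1 p)//= big1 ?addr0.
    rewrite /ket !xpair_eqE eqseq_cons !xpair_eqE eqxx /=.
    by case: eqP => //; rewrite mulr0.
  move=> p' /negbTE np; rewrite /ket xpair_eqE eqseq_cons !xpair_eqE.
  by rewrite [p == p']eq_sym np mulr0.
rewrite inner_ket_sum; apply: eq_bigr => p _.
by rewrite conjc_real mulrC.
Qed.

(** Each [wp u] lengthens tensors by one, so [k] of them leave no component on tensors shorter than
    [k]. *)
Lemma wp_pow_gt_size (u : U) k (x : vec) (b : basis) :
  (size b.1 < k)%N -> op_pow (wp u) k x b = 0.
Proof.
elim: k b => // k IH [[|[p v] w] s] /= ltk; rewrite wpE //.
by case: eqP => // _; rewrite [X in _ * X]IH ?mulr0.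
Qed.

(* The series terminates on each coordinate, so that this operator is defined
   on all vectors, whatever the growth of the cumulants. *)
Definition full_gamma (u : U) : op := fun x b =>
  annihilation u x b +
  \sum_(k < (size b.1).+1) (kappa u k.+1)%:C%C * op_pow (wp u) k x b.

Lemma wp_pow_sum_extend (u : U) n (x : vec) (b : basis) : (size b.1 <= n)%N ->
  \sum_(k < n.+1) (kappa u k.+1)%:C%C * op_pow (wp u) k x b =
  \sum_(k < (size b.1).+1) (kappa u k.+1)%:C%C * op_pow (wp u) k x b.
Proof.
move=> le; rewrite -!(big_mkord xpredT
  (fun k => (kappa u k.+1)%:C%C * op_pow (wp u) k x b)).
rewrite (big_cat_nat (n := (size b.1).+1))//= [X in _ + X]big_nat_cond.
rewrite [X in _ + X]big1 ?addr0// => k /andP[/andP[lek _] _].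
by rewrite wp_pow_gt_size ?mulr0.
Qed.

Lemma gamma_full_gamma N (u : U) (x : vec) (b : basis) : (size b.1 <= N)%N ->
  gamma d kappa N u x b = full_gamma u x b.
Proof.
move=> le; rewrite /gamma /op_add adj_wpE op_sumE; congr (_ + _).
by rewrite -(wp_pow_sum_extend _ _ le); exact: eq_bigr.
Qed.

Lemma ann_eq_local (u : U) (x y : vec) (b : basis) :
  (forall b', (size b'.1 <= (size b.1).+1)%N -> x b' = y b') ->
  annihilation u x b = annihilation u y b.
Proof. by move=> xy; apply: eq_bigr => p _; rewrite xy. Qed.

Lemma wp_pow_eq_local (u : U) k (x y : vec) (b : basis) :
  (forall b', (size b'.1 <= size b.1)%N -> x b' = y b') ->
  op_pow (wp u) k x b = op_pow (wp u) k y b.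
Proof.
elim: k b => [|k IH] b xy /=; first exact: xy.
rewrite !wpE; case: b xy => [[|[p v] w] s] //= xy.
case: eqP => // _; congr (_ * _); apply: IH => b' le.
by apply: xy; rewrite (leq_trans le).
Qed.

Lemma full_gamma_eq_local (u : U) (x y : vec) (b : basis) :
  (forall b', (size b'.1 <= (size b.1).+1)%N -> x b' = y b') ->
  full_gamma u x b = full_gamma u y b.
Proof.
move=> xy; congr (_ + _); first exact: ann_eq_local.
apply: eq_bigr => k _; congr (_ * _); apply: wp_pow_eq_local => b' le.
by apply: xy; rewrite (leq_trans le).
Qed.

(** The first factor is read at [b], and each further one at tensors longer by at most one. The last
    of the [m] factors is thus read at lengths up to [size b.1 + m - 1], whence the bound [N.+1]. *)
Lemma op_prod_eq_local N m (F G : 'I_m -> op) :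
  (forall k x y b, (size b.1 <= N)%N ->
    (forall b', (size b'.1 <= (size b.1).+1)%N -> x b' = y b') ->
    F k x b = G k y b) ->
  forall x b, (size b.1 + m <= N.+1)%N -> op_prod F x b = op_prod G x b.
Proof.
elim: m F G => [|m IH] F G FG x b le; rewrite /op_prod ?big_ord0//.
rewrite !big_ord_recl /=; apply: (FG).
  by rewrite -ltnS (leq_trans _ le)// addnS ltnS leq_addr.
move=> b' le'; apply: (IH (F \o lift ord0) (G \o lift ord0)).
  by move=> k ? ? ?; apply: FG.
by apply: leq_trans le; rewrite addnS -addSn leq_add2r.
Qed.

Lemma op_prod_gamma m (u : 'I_m -> U) (x : vec) (q : 'I_r) :
  op_prod (fun k => gamma d kappa m (u k)) x ([::], q) =
  op_prod (fun k => full_gamma (u k)) x ([::], q).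
Proof.
apply: (@op_prod_eq_local m) => // k y z b le yz.
by rewrite gamma_full_gamma//; exact: full_gamma_eq_local.
Qed.

Lemma full_gamma_lin (u : U) (z : C) (x y : vec) b :
  full_gamma u (fun b => z * x b + y b) b = z * full_gamma u x b + full_gamma u y b.
Proof.
have powlin k : op_pow (wp u) k (fun b => z * x b + y b) =
    (fun b => z * op_pow (wp u) k x b + op_pow (wp u) k y b).
  elim: k => //= k IH; rewrite IH; apply/funext => b'; rewrite !wpE.
  case: b' => [[|[p v] w] s]; first by rewrite mulr0 addr0.
  by case: eqP => _; [rewrite mulrDr mulrCA | rewrite mulr0 addr0].
rewrite /full_gamma mulrDr addrACA; congr (_ + _).
  rewrite /annihilation mulr_sumr -big_split; apply: eq_bigr => p _ /=.
  by rewrite mulrDr mulrCA.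
rewrite mulr_sumr -big_split; apply: eq_bigr => k _ /=.
by rewrite powlin mulrDr mulrCA.
Qed.

Definition sandwich (p q : 'I_r) (T : op) : op := Defs.proj p \o T \o Defs.proj q.

Definition full_gamma_hat (p q : 'I_r) (u : U) : op :=
  if p == q then sandwich q q (full_gamma u)
  else op_add (sandwich p q (full_gamma u)) (sandwich q p (full_gamma u)).

Lemma gamma_hat_sandwich N (p q : 'I_r) (u : U) x b :
  gamma_hat d kappa N p q u x b =
  (if p == q then sandwich q q (gamma d kappa N u)
   else op_add (sandwich p q (gamma d kappa N u))
               (sandwich q p (gamma d kappa N u))) x b.
Proof.
have sumE p' q' (y : vec) : (\big[op_add/op_zero]_(k < N.+1)
       op_scale (kappa u k.+1)%:C%C (Defs.proj p' \o op_pow (wp u) k \o Defs.proj q')) y b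
   = Defs.proj p' ((\big[op_add/op_zero]_(k < N.+1)
       op_scale (kappa u k.+1)%:C%C (op_pow (wp u) k)) (Defs.proj q' y)) b.
  rewrite op_sumE /Defs.proj op_sumE; case: ifP => cE.
    by apply: eq_bigr => k _; rewrite /op_scale /= cE.
  by rewrite big1// => k _; rewrite /op_scale /= cE mulr0.
have projD p' (y z : vec) : Defs.proj p' (fun b => y b + z b) b =
    Defs.proj p' y b + Defs.proj p' z b.
  by rewrite /Defs.proj; case: ifP => // _; rewrite addr0.
rewrite /gamma_hat; case: eqP => _.
  by rewrite /gamma_blk /op_add sumE /sandwich /= projD.
rewrite /gamma_blk /op_add !sumE /sandwich /= !projD.
(* [gamma_blk p q] carries the annihilation part of [sandwich q p], so the two annihilation parts
   trade places. *)
by rewrite addrACA [X in X + _]addrC addrACA.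
Qed.

Lemma op_prod_gamma_hat m (p q : 'I_m -> 'I_r) (u : 'I_m -> U) x (s : 'I_r) :
  op_prod (fun k => gamma_hat d kappa m (p k) (q k) (u k)) x ([::], s) =
  op_prod (fun k => full_gamma_hat (p k) (q k) (u k)) x ([::], s).
Proof.
apply: (@op_prod_eq_local m) => // k y z b le yz; rewrite gamma_hat_sandwich.
have sandE p' q' : sandwich p' q' (gamma d kappa m (u k)) y b =
    sandwich p' q' (full_gamma (u k)) z b.
  rewrite /sandwich /= {1 3}/Defs.proj; case: ifP => // _.
  rewrite gamma_full_gamma//; apply: full_gamma_eq_local => b' le'.
  by rewrite /Defs.proj yz.
by rewrite /full_gamma_hat; case: eqP => _; rewrite /op_add !sandE.
Qed.

End FockSpace.

(** * Freeness in the Fock space model *)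

Section FockFreeness.
Context {R : realType} {r : nat} {U : finType}.
Variables (d : 'I_r -> R) (kappa : U -> nat -> R).
Hypotheses (d_ge0 : forall q, 0 <= d q) (d_sum1 : \sum_q d q = 1).
Local Notation C := R[i].
Local Notation basis := (fock_basis r U).
Local Notation vec := (@vec R r U).
Local Notation op := (@op R r U).
Local Notation wp := (@wp R r U d).
Local Notation "'sq' p" := ((Num.sqrt (d p))%:C)%C (at level 10, p at level 9).

(** At a given tensor, [wp(a_1) ... wp(a_k) x] can be nonzero only if [a] is a prefix of the labels
    of the tensor. The recursion runs through these prefixes and collects the square root of [d p]
    for each letter removed. *)
Fixpoint word_act_seq (c : seq U -> C) (x : vec) (w : seq ('I_r * U)) (s : 'I_r) : C :=
  c [::] * x (w, s) +
  if w is (p, v) :: w' then sq p * word_act_seq (fun a => c (v :: a)) x w' s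
  else 0.

(* The vector [\sum_a c a * wp(a_1) ... wp(a_k) x], the sum being over all words
   [a = a_1 ... a_k] in [U]; it is finite in each coordinate. *)
Definition word_act (c : seq U -> C) (x : vec) : vec :=
  fun b => word_act_seq c x b.1 b.2.

Definition killed (x : vec) : Prop := forall u b, annihilation d u x b = 0.

Lemma word_act_local (c c' : seq U -> C) (x : vec) b :
  (forall a, (size a <= size b.1)%N -> c a = c' a) ->
  word_act c x b = word_act c' x b.
Proof.
case: b => w s; rewrite /word_act /=.
elim: w c c' => [|[p v] w IH] c c' cc' /=; rewrite cc'//.
by congr (_ + _ * _); apply: IH => a lea; apply: cc'.
Qed.

Lemma word_act_seq0 (x : vec) w s : word_act_seq (fun=> 0) x w s = 0.
Proof.
elim: w => [|[p v] w IH] /=; first by rewrite mul0r addr0.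
by rewrite IH mulr0 mul0r addr0.
Qed.

Lemma word_act_lin (z : C) (c c' : seq U -> C) (x : vec) b :
  word_act (fun a => z * c a + c' a) x b = z * word_act c x b + word_act c' x b.
Proof.
case: b => w s; rewrite /word_act /=.
elim: w c c' => [|[p v] w IH] c c' /=.
  by rewrite !addr0 mulrDl mulrA.
by rewrite IH !mulrDr mulrDl mulrA addrACA; congr (_ + (_ + _)); rewrite mulrCA.
Qed.

Lemma word_act_sum n (k : 'I_n -> C) (c : 'I_n -> seq U -> C) (x : vec) b :
  word_act (fun a => \sum_i k i * c i a) x b = \sum_i k i * word_act (c i) x b.
Proof.
elim: n k c => [|n IH] k c.
  rewrite big_ord0 -[RHS](word_act_seq0 x b.1 b.2).
  by apply: (@word_act_local _ (fun=> 0)) => a _; rewrite big_ord0.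
rewrite big_ord_recl -IH -word_act_lin.
by apply: word_act_local => a _; rewrite big_ord_recl.
Qed.

Definition unit_word : seq U -> C := fun a => (a == [::])%:R.

Lemma word_act_unit (x : vec) : word_act unit_word x = x.
Proof.
apply/funext => -[[|[p v] w] s]; rewrite /word_act /=.
  by rewrite /unit_word eqxx mul1r addr0.
by rewrite [X in sq _ * X]word_act_seq0 mulr0 addr0 /unit_word eqxx mul1r.
Qed.

(** [word_ann] and [word_cre] are the free annihilation and creation operators of the full Fock
    space over [U], acting on coefficients; vectors that are [killed] serve as its vacua. *)
Definition word_ann (u : U) (c : seq U -> C) : seq U -> C := fun a => c (u :: a).

Definition word_cre (u : U) (c : seq U -> C) : seq U -> C :=
  fun a => if a is v :: a' then if v == u then c a' else 0 else 0.

Lemma sqrt_sq (p : 'I_r) : sq p * sq p = (d p)%:C%C.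
Proof. by rewrite -rmorphM -expr2 sqr_sqrtr. Qed.

(** Annihilating a created letter produces the square root of [d p] twice, and the resulting weights
    [d p] sum to 1. The term of the empty word disappears because [x] is killed. *)
Lemma ann_word_act (u : U) c (x : vec) : killed x ->
  annihilation d u (word_act c x) = word_act (word_ann u c) x.
Proof.
move=> x0; apply/funext => -[w s]; rewrite /annihilation /word_act /=.
under eq_bigr do rewrite mulrDr mulrCA [sq _ * (sq _ * _)]mulrA sqrt_sq.
rewrite big_split /= -mulr_sumr.
have := x0 u (w, s); rewrite /annihilation /= => ->; rewrite mulr0 add0r.
by rewrite -mulr_suml -rmorph_sum d_sum1 mul1r.
Qed.

Lemma wp_word_act (u : U) c (x : vec) :
  wp u (word_act c x) = word_act (word_cre u c) x.
Proof.
apply/funext => b; rewrite wpE.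
case: b => [[|[p v] w] s]; rewrite /word_act /= mul0r ?addr0// add0r.
case: eqP => // _.
by rewrite word_act_seq0 mulr0.
Qed.

(** The map [t] on coefficients must not depend on the killed vector [x]; this makes the vacuum
    expectations at all [q] equal. *)
Definition shift_op (T : op) : Prop := exists t : (seq U -> C) -> (seq U -> C),
  forall c x, killed x -> T (word_act c x) = word_act (t c) x.

Definition diag_op (T : op) : Prop := exists f : 'I_r -> C,
  forall x b, T x b = f (first_index b) * x b.

Lemma shift_op_full_gamma u : shift_op (full_gamma d kappa u).
Proof.
exists (fun c a => word_ann u c a +
  \sum_(k < (size a).+1) (kappa u k.+1)%:C%C * iter k (word_cre u) c a).
move=> c x x0; apply/funext => b; rewrite /full_gamma ann_word_act//.
have powE k : op_pow (wp u) k (word_act c x) = word_act (iter k (word_cre u) c) x.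
  by elim: k => //= k IH; rewrite -wp_word_act -IH.
under eq_bigr do rewrite powE.
rewrite -word_act_sum -[word_act (word_ann u c) x b]mul1r -word_act_lin.
apply: word_act_local => a lea; rewrite mul1r; congr (_ + _).
(* [t] cannot refer to the coordinate [b], so its sum stops at the length of the word [a]. The terms
   beyond it vanish, since [k] creations produce no word shorter than [k]. *)
rewrite -!(big_mkord xpredT
  (fun k => (kappa u k.+1)%:C%C * iter k (word_cre u) c a)).
rewrite (big_cat_nat (n := (size a).+1))//= [X in _ + X]big_nat_cond.
rewrite [X in _ + X]big1 ?addr0// => k /andP[/andP[ltk _] _].
suff -> : iter k (word_cre u) c a = 0 by rewrite mulr0.
elim: k a {lea} ltk => // k IH [|v a] //= ltk.
by case: eqP => // _; exact: IH.
Qed.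

Lemma shift_op_id : shift_op id.
Proof. by exists id. Qed.

Lemma shift_op_lin z T S : shift_op T -> shift_op S ->
  shift_op (op_add (op_scale z T) S).
Proof.
move=> [t tE] [s sE]; exists (fun c a => z * t c a + s c a) => c x x0.
by apply/funext => b; rewrite word_act_lin /op_add /op_scale tE// sE.
Qed.

Lemma shift_op_comp T S : shift_op T -> shift_op S -> shift_op (T \o S).
Proof.
by move=> [t tE] [s sE]; exists (t \o s) => c x x0 /=; rewrite sE// tE.
Qed.

Lemma diag_op_proj q : diag_op (Defs.proj q).
Proof.
exists (fun p => (p == q)%:R) => x b; rewrite /Defs.proj.
by case: eqP => _; rewrite ?mul1r ?mul0r.
Qed.

Lemma diag_op_id : diag_op id.
Proof. by exists (fun=> 1) => x b; rewrite mul1r. Qed.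

Lemma diag_op_lin z T S : diag_op T -> diag_op S ->
  diag_op (op_add (op_scale z T) S).
Proof.
move=> [t tE] [s sE]; exists (fun p => z * t p + s p) => x b.
by rewrite /op_add /op_scale tE sE mulrDl mulrA.
Qed.

Lemma diag_op_comp T S : diag_op T -> diag_op S -> diag_op (T \o S).
Proof.
move=> [t tE] [s sE]; exists (fun p => t p * s p) => x b.
by rewrite /= tE sE mulrA.
Qed.

Lemma killed_vacuum q : killed (vacuum q).
Proof.
move=> u b; rewrite /annihilation big1// => p _.
by rewrite /vacuum /ket xpair_eqE mulr0.
Qed.

(** Every vacuum is a killed vector carrying the empty word, so each state gives the same value, and
    the weights of the average sum to 1. *)
Lemma Psi_shift_op (T : op) t :
  (forall c x, killed x -> T (word_act c x) = word_act (t c) x) ->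
  Psi d T = t unit_word [::].
Proof.
move=> tE; rewrite PsiE (eq_bigr (fun q => (d q)%:C%C * t unit_word [::])).
  by rewrite -mulr_suml -rmorph_sum d_sum1 mul1r.
move=> q _; rewrite -[vacuum q]word_act_unit tE; last exact: killed_vacuum.
by rewrite /word_act /= /vacuum /ket eqxx mulr1 addr0.
Qed.

Lemma Psi_diag_op (T : op) f : (forall x b, T x b = f (first_index b) * x b) ->
  Psi d T = \sum_q (d q)%:C%C * f q.
Proof.
move=> fE; rewrite PsiE; apply: eq_bigr => q _.
by rewrite fE /vacuum /ket eqxx mulr1.
Qed.

Definition in_class (b : bool) : op -> Prop := if b then shift_op else diag_op.

Definition ocomp (s : seq op) : op := \big[(fun A B : op => A \o B)/idfun]_(A <- s) A.

(* A centered element of the algebra of the [gamma u] maps vectors killed by the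
   annihilators into vectors [word_act c y] with [c [::] = 0]; a centered diagonal
   operator maps the latter back into vectors killed by the annihilators, since
   [annihilation u \o f \o wp v] is the scalar [Psi f] if [u = v] and vanishes otherwise.
   Neither kind of vector has a vacuum component. *)
Lemma alternating_vacuum (s : seq (bool * op)) q :
  s != [::] ->
  all (fun t => `[< in_class t.1 t.2 /\ Psi d t.2 = 0 >]) s ->
  sorted (fun t t' => t.1 != t'.1) s ->
  let x := ocomp (map snd s) (vacuum q) in
  if head true (map fst s)
  then exists c y, [/\ c [::] = 0, killed y & x = word_act c y]
  else killed x /\ ((1 < size s)%N -> forall p, x ([::], p) = 0).
Proof.
elim: s => // -[b T] s IH _ cent alt; rewrite /ocomp /= big_cons -/(ocomp _) /=.
move: cent => /= /andP[/asboolP[clT PT] centS].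
have alts : sorted (fun t t' : bool * op => t.1 != t'.1) s.
  by case: s alt {IH centS} => //= ? ? /andP[].
case: b clT alt => /= clT alt.
  have kx : killed (ocomp (map snd s) (vacuum q)).
    case: s alt IH alts centS => [_ _ _ _|[[] S] s //= _ IH alts centS].
      by rewrite /ocomp big_nil; exact: killed_vacuum.
    by case: (IH isT centS alts).
  have [t tE] := clT; exists (t unit_word), (ocomp (map snd s) (vacuum q)).
  by split => //; [rewrite -(Psi_shift_op tE) | rewrite -tE// word_act_unit].
have [f fE] := clT; move: PT; rewrite (Psi_diag_op fE) => f0.
case: s alt IH alts centS => [_ _ _ _|[[] S] s //= _ IH alts centS].
  split=> // u b; rewrite /ocomp /= big_nil /= /annihilation big1// => p _.
  by rewrite fE /vacuum /ket xpair_eqE !mulr0.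
have [c [y [c0 ky ->]]] := IH isT centS alts; split => [u b|_ p].
  rewrite /annihilation.
  rewrite (eq_bigr (fun p => (d p)%:C%C * f p * word_act (word_ann u c) y b)).
    by rewrite -mulr_suml f0 mul0r.
  move=> p _; rewrite fE /= /first_index /= /word_act /= c0 mul0r add0r.
  by rewrite mulrCA [sq _ * (sq _ * _)]mulrA sqrt_sq mulrA [f p * _]mulrC.
by rewrite fE /word_act /= c0 mul0r addr0 mulr0.
Qed.

Lemma Psi_alternating (s : seq (bool * op)) :
  s != [::] ->
  all (fun t => `[< in_class t.1 t.2 /\ Psi d t.2 = 0 >]) s ->
  sorted (fun t t' => t.1 != t'.1) s ->
  Psi d (ocomp (map snd s)) = 0.
Proof.
(* A single factor is treated apart: a centered diagonal operator may have nonzero vacuum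
   components, only their weighted average vanishes. *)
case: s => // t [|t' s] _ cent alt.
  by rewrite /ocomp /= big_cons big_nil; case/andP: cent => /asboolP[_].
rewrite PsiE big1// => q _.
have := @alternating_vacuum [:: t, t' & s] q isT cent alt; cbv zeta.
case: ifP => _; last by case=> _ ->//; rewrite mulr0.
by case=> c [y [c0 ky ->]]; rewrite /word_act /= c0 mul0r addr0 mulr0.
Qed.

End FockFreeness.

(** * Joint moments of free families are determined by the marginal ones *)

Lemma not_sorted_split (T : Type) (e : rel T) (s : seq T) : ~~ sorted e s ->
  exists s1 t t' s2, s = s1 ++ [:: t, t' & s2] /\ ~~ e t t'.
Proof.
elim: s => // t [//|t' s] IH /=; rewrite negb_and => /orP[nett'|nes].
  by exists [::], t, t', s.
have [s1 [t1 [t2 [s2 [-> ne]]]]] := IH nes.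
by exists (t :: s1), t1, t2, s2.
Qed.

Section JointMoments.
Context {R : realType} {r : nat} {U : finType}.
Variable d : 'I_r -> R.
Hypotheses (d_ge0 : forall q, 0 <= d q) (d_sum1 : \sum_q d q = 1).
Local Notation C := R[i].
Local Notation vec := (@vec R r U).
Local Notation op := (@op R r U).
Variables (A : algType C) (phi : {scalar A}).

(** An [op] is an arbitrary map, so linearity is recorded as a property. It is needed to split a sum
    standing to the right of other factors. *)
Definition lin_op (T : op) : Prop := forall z x y,
  T (fun b => z * x b + y b) = (fun b => z * T x b + T y b).

Lemma lin_op_comp T S : lin_op T -> lin_op S -> lin_op (T \o S).
Proof. by move=> hT hS z x y; rewrite /= hS hT. Qed.

Lemma lin_op_lin z T S : lin_op T -> lin_op S ->
  lin_op (op_add (op_scale z T) S).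
Proof.
move=> hT hS c x y; apply/funext => b.
by rewrite /op_add /op_scale hT hS !mulrDr addrACA mulrCA.
Qed.

Lemma ocomp_cons (T : op) s : ocomp (T :: s) = T \o ocomp s.
Proof. exact: big_cons. Qed.

Lemma lin_op_ocomp (s : seq op) : foldr (fun T P => lin_op T /\ P) True s ->
  lin_op (ocomp s).
Proof.
elim: s => [_ z x y|T s IH [hT hs]]; first by rewrite /ocomp big_nil.
by rewrite ocomp_cons; apply: lin_op_comp => //; exact: IH.
Qed.

Lemma ocomp_cat (s1 s2 : seq op) : ocomp (s1 ++ s2) = ocomp s1 \o ocomp s2.
Proof.
elim: s1 => [|T s IH]; first by rewrite {2}/ocomp big_nil.
by rewrite /= !ocomp_cons IH.
Qed.

Lemma Psi_lin z (T S : op) :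
  Psi d (op_add (op_scale z T) S) = z * Psi d T + Psi d S.
Proof.
rewrite !PsiE mulr_sumr -big_split; apply: eq_bigr => q _ /=.
by rewrite /op_add /op_scale mulrDr mulrCA.
Qed.

Lemma Psi_id : Psi d (id : op) = 1.
Proof.
rewrite (@Psi_diag_op _ _ _ d id (fun=> 1)) => [|x b]; last by rewrite mul1r.
by under eq_bigr do rewrite mulr1; rewrite -rmorph_sum d_sum1.
Qed.

(* [B true] and [B false] are graphs of correspondences between two pairs of
   subalgebras: [B b a T] says that [T] is the counterpart of [a]. *)
Variable B : bool -> A -> op -> Prop.
Hypotheses
  (B1 : forall b, B b 1 id)
  (Blin : forall b z a a' T T', B b a T -> B b a' T' ->
     B b (z *: a + a') (op_add (op_scale z T) T'))
  (Bmul : forall b a a' T T', B b a T -> B b a' T' -> B b (a * a') (T \o T'))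
  (Bphi : forall b a T, B b a T -> phi a = Psi d T)
  (Bclass : forall b a T, B b a T -> in_class d b T)
  (Blin_op : forall b a T, B b a T -> lin_op T)
  (Bfree : forall s : seq (bool * (A * op)), s != [::] ->
     all (fun t => `[< B t.1 t.2.1 t.2.2 /\ phi t.2.1 = 0 >]) s ->
     sorted (fun b b' => b != b') (map fst s) ->
     phi (\prod_(t <- s) t.2.1) = 0).

Let moments_agree (s : seq (bool * (A * op))) :=
  phi (\prod_(t <- s) t.2.1) = Psi d (ocomp [seq t.2.2 | t <- s]).

Let corresp (s : seq (bool * (A * op))) :=
  all (fun t => `[< B t.1 t.2.1 t.2.2 >]) s.

(** Both sides vanish: the left one by freeness under [phi], the right one by the Fock space
    computation. *)
Lemma centered_moments_agree (s : seq (bool * (A * op))) : s != [::] ->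
  all (fun t => `[< B t.1 t.2.1 t.2.2 /\ phi t.2.1 = 0 >]) s ->
  sorted (fun b b' => b != b') (map fst s) -> moments_agree s.
Proof.
move=> s0 cs alt; rewrite /moments_agree Bfree//.
have -> : [seq t.2.2 | t <- s] = map snd [seq (t.1, t.2.2) | t <- s].
  by rewrite -map_comp.
rewrite (Psi_alternating d_ge0 d_sum1)//.
- by case: s s0 {cs alt}.
- rewrite all_map; apply: sub_all cs => t /asboolP[Bt pt]; apply/asboolP.
  by split; [exact: Bclass Bt | rewrite -(Bphi Bt)].
- by move: alt; rewrite !sorted_map.
Qed.

Lemma corresp_lin_op s : corresp s -> lin_op (ocomp [seq t.2.2 | t <- s]).
Proof.
move=> cs; apply: lin_op_ocomp; elim: s cs => //= t s IH /andP[/asboolP Bt cs].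
by split; [exact: Blin_op Bt | exact: IH].
Qed.

(* Neighbouring factors from the same subalgebra are merged; once none are left,
   the factors are centered one at a time, the difference being a scalar multiple
   of a shorter product. *)
Lemma free_moments_agree s : corresp s -> moments_agree s.
Proof.
have [n] := ubnP (size s); elim: n s => // n IH s; rewrite ltnS => les cs.
have [->|s0] := eqVneq s [::].
  by rewrite /moments_agree /ocomp !big_nil (Bphi (B1 true)).
have [alt|] := boolP (sorted (fun b b' => b != b') (map fst s)).
  (* The induction is on [s2]: [s1] holds the factors already centered, [s2] those still to be
     centered. *)
  suff: forall s1 s2,
      all (fun t => `[< B t.1 t.2.1 t.2.2 /\ phi t.2.1 = 0 >]) s1 -> corresp s2 ->
      (size (s1 ++ s2) <= n)%N -> s1 ++ s2 != [::] ->
      sorted (fun b b' => b != b') (map fst (s1 ++ s2)) ->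
      moments_agree (s1 ++ s2).
    by move=> /(_ [::] s); apply.
  move=> s1 s2; elim: s2 s1 => [|[b [a T]] s2 IH2] s1 cs1.
    by rewrite cats0 => *; exact: centered_moments_agree.
  move=> /= /andP[/asboolP /= Bt cs2] le12 _ alt12.
  pose c := phi a; pose a' := (- c) *: 1 + a.
  pose T' := op_add (op_scale (- c) id) T : op.
  have Bt' : B b a' T' by exact: Blin.
  have pa' : phi a' = 0.
    by rewrite linearP /= (Bphi (B1 true)) Psi_id mulr1 addNr.
  have corr1 : corresp s1 by apply: sub_all cs1 => t /asboolP[? _]; apply/asboolP.
  have := IH2 (rcons s1 (b, (a', T'))).
  rewrite all_rcons cs1 andbT cat_rcons => /(_ _ cs2); rewrite /moments_agree => h.
  have {}h : phi (\prod_(t <- s1 ++ (b, (a', T')) :: s2) t.2.1) =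
     Psi d (ocomp [seq t.2.2 | t <- s1 ++ (b, (a', T')) :: s2]).
    apply: h; first by apply/asboolP.
    - by move: le12; rewrite !size_cat.
    - by case: (s1).
    - by move: alt12; rewrite !map_cat.
  have hs : moments_agree (s1 ++ s2).
    apply: IH; last by rewrite /corresp all_cat; apply/andP; split.
    by move: le12; rewrite !size_cat /= addnS.
  have -> : \prod_(t <- s1 ++ (b, (a, T)) :: s2) t.2.1 =
      c *: \prod_(t <- s1 ++ s2) t.2.1 +
      \prod_(t <- s1 ++ (b, (a', T')) :: s2) t.2.1.
    rewrite !big_cat /= !big_cons /= /a' mulrDl mulrDr addrA.
    by rewrite -scalerAl mul1r -scalerAr scaleNr addrN add0r.
  rewrite linearP /= h hs -Psi_lin; congr (Psi d _).
  (* On the operator side, the splitting of [T] into its mean and [T'] passes through the factors on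
     its left by their linearity. *)
  apply/funext => x; apply/funext => b'.
  rewrite !map_cat /= /op_add /op_scale !ocomp_cat /= !ocomp_cons /=.
  set y := ocomp _ x; pose L := ocomp [seq t.2.2 | t <- s1].
  rewrite -[LHS]/((fun b => c * L y b + L (T' y) b) b').
  rewrite -(corresp_lin_op corr1); congr (L _ _); apply/funext => b''.
  by rewrite /T' /op_add /op_scale addrA mulNr addrN add0r.
rewrite sorted_map => /not_sorted_split.
move=> [s1 [[b [a T]] [[b' [a' T']] [s2 [sE' /negPn/eqP ebb']]]]].
move: cs; rewrite /= in ebb'; subst b'; rewrite sE' /corresp all_cat => /andP[cs1].
move=> /= /andP[/asboolP /= Bt] /andP[/asboolP /= Bt' cs2].
have hm : moments_agree (s1 ++ (b, (a * a', T \o T')) :: s2).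
  apply: IH; first by move: les; rewrite sE' !size_cat /= !addnS.
  rewrite /corresp all_cat; apply/andP; split=> //=; apply/andP; split=> //.
  by apply/asboolP; exact: Bmul.
move: hm; rewrite /moments_agree !big_cat /= !big_cons /= !mulrA => ->.
by rewrite !map_cat /= !ocomp_cat !ocomp_cons.
Qed.

End JointMoments.

(** * Expectations of products of entries *)

Section Integrability.
Context {R : realType} {disp : measure_display} {Omega : measurableType disp}.
Variable P : probability Omega R.
Local Notation C := R[i].
Local Notation Linf := (in_Linfty_minus P).

Lemma Lfun_powR_integrable (f : Omega -> R) (s : R) : 1 <= s ->
  measurable_fun setT f ->
  P.-integrable setT (fun x => (`|f x| `^ s)%:E) -> f \in Lfun P s%:E.
Proof.
move=> s1 mf /integrableP[_ fi]; rewrite inE; apply/andP.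
split; rewrite inE//= /finite_norm unlock poweR_lty//.
apply: le_lt_trans fi; rewrite le_eqVlt; apply/orP; left; apply/eqP.
by apply: eq_integral => x _ /=; rewrite [in RHS]ger0_norm ?powR_ge0.
Qed.

Lemma Lfun_measurable (f : Omega -> R) (s : \bar R) :
  f \in Lfun P s -> measurable_fun setT f.
Proof. by rewrite inE => /andP[/[!inE]]. Qed.

(** This is the Cauchy-Schwarz inequality applied to the [s]-th powers of the absolute values of [f]
    and [g], which are square-integrable. *)
Lemma LfunM (f g : Omega -> R) (s : R) : 1 <= s ->
  f \in Lfun P (2 * s)%:E -> g \in Lfun P (2 * s)%:E ->
  (fun x => f x * g x) \in Lfun P s%:E.
Proof.
move=> s1 hf hg.
have s21 : 1 <= 2 * s by rewrite (le_trans s1)// ler_peMl ?(le_trans ler01)// ler1n.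
have sq h : h \in Lfun P (2 * s)%:E -> (fun x => `|h x| `^ s) \in Lfun P 2%:E.
  move=> hh; apply: Lfun_powR_integrable; first by rewrite ler1n.
    apply: (@measurableT_comp _ _ _ _ _ _ (@powR R ^~ s)) => //.
    by apply: measurableT_comp => //; exact: Lfun_measurable hh.
  have := Lfun_integrable s21 hh; congr (_.-integrable _ _).
  by apply/funext => x; rewrite [`|_ `^ _|]ger0_norm ?powR_ge0// -powRrM mulrC.
apply: Lfun_powR_integrable => //.
  by apply: measurable_funM; [exact: Lfun_measurable hf | exact: Lfun_measurable hg].
have /Lfun1_integrable := Lfun2_mul_Lfun1 (sq f hf) (sq g hg).
congr (_.-integrable _ _); apply/funext => x /=.
by rewrite normrM powRM.
Qed.

Lemma LinfD (f g : Omega -> C) : Linf f -> Linf g -> Linf (fun x => f x + g x).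
Proof.
move=> hf hg s s1; have [f1 f2] := hf s s1; have [g1 g2] := hg s s1.
have s1' : (1%:E <= s%:E)%E by rewrite lee_fin.
have D (a b : Omega -> R) : a \in Lfun P s%:E -> b \in Lfun P s%:E ->
  (fun x => a x + b x) \in Lfun P s%:E := (Lfun_addr_closed P s1').2 a b.
split.
  rewrite (_ : (fun _ => _) = fun x => complex.Re (f x) + complex.Re (g x)).
    exact: D.
  by apply/funext => x; case: (f x); case: (g x).
rewrite (_ : (fun _ => _) = fun x => complex.Im (f x) + complex.Im (g x)).
  exact: D.
by apply/funext => x; case: (f x); case: (g x).
Qed.

(** Exponent [s] for a product costs exponent [2 * s] for its factors, which is available because
    all finite exponents are. *)
Lemma LinfM (f g : Omega -> C) : Linf f -> Linf g -> Linf (fun x => f x * g x).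
Proof.
move=> hf hg s s1.
have s21 : 1 <= 2 * s by rewrite (le_trans s1)// ler_peMl ?(le_trans ler01)// ler1n.
have [f1 f2] := hf _ s21; have [g1 g2] := hg _ s21.
have s1' : (1%:E <= s%:E)%E by rewrite lee_fin.
have D (a b : Omega -> R) : a \in Lfun P s%:E -> b \in Lfun P s%:E ->
  (fun x => a x + b x) \in Lfun P s%:E := (Lfun_addr_closed P s1').2 a b.
have N (a : Omega -> R) : a \in Lfun P s%:E -> (fun x => - a x) \in Lfun P s%:E :=
  @Lfun_oppr_closed _ _ _ P _ a.
split.
  rewrite (_ : (fun _ => _) = fun x => complex.Re (f x) * complex.Re (g x) +
      - (complex.Im (f x) * complex.Im (g x))).
    by apply: D; [|apply: N]; exact: LfunM.
  by apply/funext => x; case: (f x) => ? ?; case: (g x).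
rewrite (_ : (fun _ => _) = fun x => complex.Re (f x) * complex.Im (g x) +
    complex.Im (f x) * complex.Re (g x)).
  by apply: D; exact: LfunM.
by apply/funext => x; case: (f x) => ? ?; case: (g x).
Qed.

Lemma Linf_cst (z : C) : Linf (fun=> z).
Proof. by move=> s s1; split; exact: Lfun_cst. Qed.

Lemma Linf_sum (I : Type) (s : seq I) (F : I -> Omega -> C) :
  (forall i, Linf (F i)) -> Linf (fun x => \sum_(i <- s) F i x).
Proof.
move=> hF; elim: s => [|i s IH].
  rewrite (_ : (fun _ => _) = fun=> 0); first exact: Linf_cst.
  by apply/funext => x; rewrite big_nil.
rewrite (_ : (fun _ => _) = fun x => F i x + \sum_(i <- s) F i x).
  exact: LinfD.
by apply/funext => x; rewrite big_cons.
Qed.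

Lemma cexpectation_lin (z : C) (f g : Omega -> C) : Linf f -> Linf g ->
  cexpectation P (fun x => z * f x + g x) =
  z * cexpectation P f + cexpectation P g.
Proof.
move=> hf hg; have [f1 f2] := hf 1 (lexx _); have [g1 g2] := hg 1 (lexx _).
have E (h : Omega -> R) : h \in Lfun P 1 ->
  'E_P[h]%E = (fine 'E_P[h])%:E%E by move=> hh; rewrite fineK// expectation_fin_num.
(* One real identity serves both components of the product with [a + ib]: the coefficients are [a],
   [-b] for the real part and [a], [b] for the imaginary part. *)
have lin (a b : R) (h k l : Omega -> R) : h \in Lfun P 1 -> k \in Lfun P 1 ->
    l \in Lfun P 1 ->
    fine 'E_P[(fun x => a * h x + b * k x + l x)%R]%E =
    a * fine 'E_P[h]%E + b * fine 'E_P[k]%E + fine 'E_P[l]%E.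
  move=> hh hk hl.
  have ah : a \o* h \in Lfun P 1 by apply: Lfun_scale.
  have bk : b \o* k \in Lfun P 1 by apply: Lfun_scale.
  have ahbk : (a \o* h) \+ (b \o* k) \in Lfun P 1.
    by apply: (Lfun_addr_closed P (lexx _)).2.
  rewrite (_ : (fun _ => _) = ((a \o* h) \+ (b \o* k)) \+ l); last first.
    by apply/funext => x /=; rewrite [a * _]mulrC [b * _]mulrC.
  rewrite expectationD// expectationD// !expectationZl//.
  by rewrite (E h)// (E k)// (E l)//=.
rewrite /cexpectation; case: z => a b; apply/eqP; rewrite eq_complex /=.
apply/andP; split; apply/eqP.
  rewrite -mulNr -lin//; congr (fine 'E_P[_]%E); apply/funext => x.
  by case: (f x) => ? ?; case: (g x) => ? ? /=; rewrite mulNr.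
rewrite -lin//; congr (fine 'E_P[_]%E); apply/funext => x.
by case: (f x) => ? ?; case: (g x) => ? ? /=.
Qed.

Definition Linf_mx n (X : Omega -> 'M[C]_n) : Prop :=
  forall i j, Linf (fun x => X x i j).

Lemma Linf_mx_cst n (A : 'M[C]_n) : Linf_mx (fun=> A).
Proof. by move=> i j; exact: Linf_cst. Qed.

Lemma Linf_mx_lin n z (X Y : Omega -> 'M[C]_n) : Linf_mx X -> Linf_mx Y ->
  Linf_mx (fun x => z *: X x + Y x).
Proof.
move=> hX hY i j.
rewrite (_ : (fun _ => _) = fun x => z * X x i j + Y x i j).
  by apply: LinfD => //; apply: LinfM => //; exact: Linf_cst.
by apply/funext => x; rewrite !mxE.
Qed.

Lemma Linf_mx_mul n (X Y : Omega -> 'M[C]_n) : Linf_mx X -> Linf_mx Y ->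
  Linf_mx (fun x => X x * Y x).
Proof.
move=> hX hY i j.
rewrite (_ : (fun _ => _) = fun x => \sum_k X x i k * Y x k j).
  by apply: Linf_sum => k; exact: LinfM.
by apply/funext => x; rewrite -[X x * _]/(X x *m _) !mxE.
Qed.

Lemma tau_lin n z (X Y : Omega -> 'M[C]_n) : Linf_mx X -> Linf_mx Y ->
  tau P (fun x => z *: X x + Y x) = z * tau P X + tau P Y.
Proof.
have tr (Z : Omega -> 'M[C]_n) : Linf_mx Z -> Linf (fun x => n%:R^-1 * \tr (Z x)).
  by move=> hZ; apply: LinfM; [exact: Linf_cst | apply: Linf_sum => i; exact: hZ].
move=> hX hY; rewrite /tau -cexpectation_lin; [|exact: tr|exact: tr].
congr (cexpectation P _); apply/funext => x.
by rewrite linearP /= mulrDr mulrCA.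
Qed.

End Integrability.

(** * Limits of complex sequences *)

Section Limits.
Context {R : realType}.
Local Notation C := R[i].

Lemma cvg_lin (K : numFieldType) (c : K) (z z' : nat -> K) l l' :
  z @ \oo --> l -> z' @ \oo --> l' ->
  (fun n => c * z n + z' n) @ \oo --> c * l + l'.
Proof.
by move=> zl zl'; apply: cvgD => //; apply: cvgM => //; exact: cvg_cst.
Qed.

Lemma ccvg_lin (c : C) (z z' : nat -> C) l l' : ccvg z l -> ccvg z' l' ->
  ccvg (fun n => c * z n + z' n) (c * l + l').
Proof. exact: (@cvg_lin R[i]). Qed.

Lemma ccvg_mul (z z' : nat -> C) l l' : ccvg z l -> ccvg z' l' ->
  ccvg (fun n => z n * z' n) (l * l').
Proof. exact: (@cvgM R[i] _ \oo _ z z'). Qed.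

Lemma ccvg_inv (z : nat -> C) l : l != 0 -> ccvg z l ->
  ccvg (fun n => (z n)^-1) l^-1.
Proof. exact: (@cvgV R[i] _ \oo _ z). Qed.

Lemma ccvg_unique (z : nat -> C) (l l' : C) :
  ccvg z l -> ccvg z l' -> l = l'.
Proof. by move=> h h'; apply: (cvg_unique _ h h'); exact: norm_hausdorff. Qed.

Lemma ccvg_cst (c : C) : ccvg (fun=> c) c.
Proof. exact: (@cvg_cst (Cplx R)). Qed.

Lemma ccvg_sum (I : Type) (s : seq I) (z : I -> nat -> C) (l : I -> C) :
  (forall i, ccvg (z i) (l i)) ->
  ccvg (fun n => \sum_(i <- s) z i n) (\sum_(i <- s) l i).
Proof.
move=> zl; elim: s => [|i s IH].
  rewrite big_nil (_ : (fun _ => _) = fun=> 0); first exact: ccvg_cst.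
  by apply/funext => n; rewrite big_nil.
have := @ccvg_lin 1 _ _ _ _ (zl i) IH; rewrite mul1r big_cons.
rewrite (_ : (fun _ => _) = fun n => \sum_(i <- i :: s) z i n) => [//|].
by apply/funext => n; rewrite big_cons mul1r.
Qed.

Lemma ccvg_real (x : nat -> R) (l : R) : x @ \oo --> l ->
  ccvg (fun n => (x n)%:C%C) (l%:C)%C.
Proof.
move=> /cvgrPdist_lt xl; apply/(@cvgrPdist_lt _ (Cplx R)) => -[e e'].
(* A positive element of [R[i]] has zero imaginary part, so the radius is a positive real number. *)
rewrite ltcE /= => /andP[/eqP -> e0].
near=> n; rewrite -rmorphB normc_def /= expr0n addr0 sqrtr_sqr ltcR.
by near: n; exact: xl.
Unshelve. all: by end_near. Qed.

Lemma ccvg_eventually (n0 : nat) (z z' : nat -> C) l :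
  (forall n, (n0 <= n)%N -> z n = z' n) -> ccvg z l -> ccvg z' l.
Proof.
move=> zz'; apply: cvg_trans; apply: near_eq_cvg; near=> n.
by apply: zz'; near: n; exact: nbhs_infty_ge.
Unshelve. all: by end_near. Qed.

End Limits.

(** * The partial trace as a normalized trace against a block projection *)

Section PartialTrace.
Context {R : realType} {disp : measure_display} {Omega : measurableType disp}.
Variable P : probability Omega R.
Local Notation C := R[i].

Lemma cexpectation_cst (z : C) : cexpectation P (fun=> z) = z.
Proof.
have E r : ('E_P[fun=> r] = r%:E)%E := expectation_cst P r.
by rewrite /cexpectation !E; case: z.
Qed.

(** The trace of [blockD S * X] is the sum of the diagonal entries of [X] over [S], so only the
    normalizations differ. For empty [S] both sides are 0, as the inverse of 0 is 0. *)
Lemma ptau_blockD n (S : {set 'I_n}) (X : Omega -> 'M[C]_n) : (0 < n)%N ->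
  Linf_mx P X ->
  ptau P S X = (#|S|%:R / n%:R : R)%:C%C^-1 * tau P (fun x => blockD S * X x).
Proof.
move=> n0 hX; rewrite /ptau /tau.
have L : in_Linfty_minus P (fun x => n%:R^-1 * \tr (blockD S * X x)).
  apply: LinfM; first exact: Linf_cst.
  by apply: Linf_sum => i; apply: Linf_mx_mul => //; exact: Linf_mx_cst.
have := cexpectation_lin n%:R L (Linf_cst P 0); rewrite cexpectation_cst addr0.
rewrite (_ : (fun _ => _) = fun x => \sum_(j in S) X x j j) => [->|].
  by rewrite mulrA; congr (_ * _); rewrite fmorph_div !rmorph_nat invf_div mulrC.
apply/funext => x; rewrite addr0 mulrA divff ?mul1r ?pnatr_eq0 -?lt0n//.
rewrite [RHS]big_mkcond; apply: eq_bigr => j _.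
rewrite -[blockD S * _]/(blockD S *m _) mul_diag_mx !mxE.
by case: (j \in S); rewrite ?mul1r ?mul0r.
Qed.

End PartialTrace.

(** * Comparison of mixed moments *)

Section MixedMoments.
Context {R : realType} {disp : measure_display} {Omega : measurableType disp}.
Variable P : probability Omega R.
Context {r : nat} {U : finType}.
Variables (N : forall n, 'I_r -> {set 'I_n}) (d : 'I_r -> R).
Variables (kappa : U -> nat -> R) (Y : U -> forall n, Omega -> 'M[R[i]]_n).
Variables (A : algType R[i]) (phi : {scalar A}) (y : U -> A) (z : 'I_r -> A).
Local Notation C := R[i].
Local Notation op := (@op R r U).
Local Notation letter := (U + 'I_r)%type.
Local Notation mats := (forall n, Omega -> 'M[C]_n).

Definition mx_letter (l : letter) : mats := fun n x =>
  match l with inl u => Y u n x | inr q => blockD (N n q) end.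
Definition alg_letter (l : letter) : A :=
  match l with inl u => y u | inr q => z q end.
Definition op_letter (l : letter) : op :=
  match l with inl u => full_gamma d kappa u | inr q => Defs.proj q end.

(* [gen_triple K X a T]: some noncommutative polynomial evaluates to [X], [a] and
   [T] in the random matrices, in the free model and in the Fock space model. *)
Inductive gen_triple (K : pred letter) : mats -> A -> op -> Prop :=
| gen_triple_one : gen_triple K (fun n _ => 1) 1 id
| gen_triple_letter l : K l ->
    gen_triple K (mx_letter l) (alg_letter l) (op_letter l)
| gen_triple_lin (c : C) X X' a a' T T' :
    gen_triple K X a T -> gen_triple K X' a' T' ->
    gen_triple K (fun n x => c *: X n x + X' n x) (c *: a + a')
      (op_add (op_scale c T) T')
| gen_triple_mul X X' a a' T T' :
    gen_triple K X a T -> gen_triple K X' a' T' ->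
    gen_triple K (fun n x => X n x * X' n x) (a * a') (T \o T').

Lemma mats_ext (X X' : mats) : (forall n x, X n x = X' n x) -> X = X'.
Proof. by move=> XX'; apply: functional_extensionality_dep => n; apply/funext. Qed.

(** Polynomials in expanded form, as linear combinations of words: convergence and moments are known
    on words and extend by linearity. *)
Inductive word_triple (K : pred letter) : mats -> A -> op -> Prop :=
| word_triple_word w : all K w ->
    word_triple K (fun n x => \prod_(l <- w) mx_letter l n x)
      (\prod_(l <- w) alg_letter l) (ocomp (map op_letter w))
| word_triple_lin (c : C) X X' a a' T T' :
    word_triple K X a T -> word_triple K X' a' T' ->
    word_triple K (fun n x => c *: X n x + X' n x) (c *: a + a')
      (op_add (op_scale c T) T').

Lemma lin_op_letter l : lin_op (op_letter l).
Proof.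
case: l => [u|q] c x x'; apply/funext => b /=.
  exact: full_gamma_lin.
by rewrite /Defs.proj; case: ifP => // _; rewrite mulr0 addr0.
Qed.

Lemma lin_op_gen_triple K X a T : gen_triple K X a T -> lin_op T.
Proof.
elim=> //= [l _|c X1 X2 a1 a2 T1 T2 _ h1 _ h2|X1 X2 a1 a2 T1 T2 _ h1 _ h2].
- exact: lin_op_letter.
- exact: lin_op_lin.
- exact: lin_op_comp.
Qed.

(** Keeping an arbitrary expanded factor on the right lets the induction run on the left one.
    Distributing a letter over a sum on its right uses the linearity of its operator. *)
Lemma gen_triple_word_triple_mul K X a T X' a' T' :
  gen_triple K X a T -> word_triple K X' a' T' ->
  word_triple K (fun n x => X n x * X' n x) (a * a') (T \o T').
Proof.
move=> g; elim: g X' a' T' => {X a T}.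
- move=> X' a' T'; rewrite mul1r; congr word_triple.
  by apply: mats_ext => n x; rewrite mul1r.
- move=> l Kl X' a' T'; elim=> {X' a' T'}.
    move=> w Kw; have := @word_triple_word K (l :: w).
    rewrite /= Kl => /(_ Kw); rewrite big_cons ocomp_cons; congr word_triple.
    by apply: mats_ext => n x; rewrite big_cons.
  move=> c X X' a a' T T' _ h _ h'.
  have := word_triple_lin c h h'; congr word_triple.
  + by apply: mats_ext => n x; rewrite mulrDr; congr (_ + _); exact: scalemxAr.
  + by rewrite mulrDr -scalerAr.
  + by apply/funext => x /=; rewrite (lin_op_letter l).
- move=> c X1 X2 a1 a2 T1 T2 _ h1 _ h2 X' a' T' w.
  have := word_triple_lin c (h1 _ _ _ w) (h2 _ _ _ w); congr word_triple.
  + by apply: mats_ext => n x; rewrite mulrDl; congr (_ + _); exact: scalemxAl.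
  + by rewrite mulrDl -scalerAl.
- move=> X1 X2 a1 a2 T1 T2 _ h1 _ h2 X' a' T' w.
  have := h1 _ _ _ (h2 _ _ _ w); congr word_triple; last by rewrite mulrA.
  by apply: mats_ext => n x; rewrite mulrA.
Qed.

Lemma gen_triple_word_triple K X a T :
  gen_triple K X a T -> word_triple K X a T.
Proof.
move=> g; have := gen_triple_word_triple_mul g (@word_triple_word K [::] isT).
rewrite big_nil mulr1 /ocomp /= big_nil; congr word_triple.
by apply: mats_ext => n x; rewrite big_nil mulr1.
Qed.

Lemma word_triple_moment K X a T :
  (forall w, all K w ->
     phi (\prod_(l <- w) alg_letter l) = Psi d (ocomp (map op_letter w))) ->
  word_triple K X a T -> phi a = Psi d T.
Proof.
move=> hw; elim=> [w /hw//|c X1 X2 a1 a2 T1 T2 _ h1 _ h2].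
by rewrite linearP /= h1 h2 Psi_lin.
Qed.

Hypotheses
  (hN : forall n, (r <= n)%N -> interval_partition (N n))
  (hd : forall q, (fun n => #|N n q|%:R / n%:R : R) @ \oo --> d q)
  (hd0 : forall q, 0 <= d q)
  (hYL : forall u n i j, in_Linfty_minus P (fun x => Y u n x i j))
  (hYlim : forall (m : nat) (u : 'I_m -> U),
     ccvg (fun n => tau P (fun x => \prod_(k < m) Y (u k) n x))
          (Psi d (op_prod (fun k => gamma d kappa m (u k)))))
  (phi1 : phi 1 = 1)
  (hfree : free_families phi y z)
  (hjoint : forall (m : nat) (l : 'I_m -> letter),
     ccvg (fun n => tau P (fun x => \prod_(k < m) match l k with
                                                  | inl i => Y i n x
                                                  | inr j => blockD (N n j)
                                                  end))
          (phi (\prod_(k < m) match l k with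
                              | inl i => y i
                              | inr j => z j
                              end))).

(** * Limits of words and marginal moments *)

Lemma word_cvg (w : seq letter) :
  ccvg (fun n => tau P (fun x => \prod_(l <- w) mx_letter l n x))
       (phi (\prod_(l <- w) alg_letter l)).
Proof.
rewrite big_tnth.
rewrite (_ : (fun n => _) = fun n => tau P (fun x =>
  \prod_(k < size w) mx_letter (tnth (in_tuple w) k) n x)).
  exact: (@hjoint _ (tnth (in_tuple w))).
by apply/funext => n; congr tau; apply/funext => x; rewrite big_tnth.
Qed.

Lemma Linf_mx_letter l n : Linf_mx P (mx_letter l n).
Proof.
by case: l => [u|q] i j; [exact: hYL | exact: Linf_mx_cst].
Qed.

Lemma Linf_mx_word (w : seq letter) n :
  Linf_mx P (fun x => \prod_(l <- w) mx_letter l n x).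
Proof.
elim: w => [|l w IH].
  rewrite (_ : (fun _ => _) = fun=> 1); first exact: Linf_mx_cst.
  by apply/funext => x; rewrite big_nil.
rewrite (_ : (fun _ => _) =
    fun x => mx_letter l n x * \prod_(l <- w) mx_letter l n x).
  by apply: Linf_mx_mul => //; exact: Linf_mx_letter.
by apply/funext => x; rewrite big_cons.
Qed.

Lemma word_triple_cvg K X a T : word_triple K X a T ->
  (forall n, Linf_mx P (X n)) /\ ccvg (fun n => tau P (X n)) (phi a).
Proof.
elim=> [w _|c X1 X2 a1 a2 T1 T2 _ [L1 h1] _ [L2 h2]].
  by split=> [n|]; [exact: Linf_mx_word | exact: word_cvg].
split=> [n|]; first exact: Linf_mx_lin.
have := @ccvg_lin _ c _ _ _ _ h1 h2; rewrite linearP; congr ccvg.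
by apply/funext => n; rewrite tau_lin.
Qed.

(** Each index [j] lies in exactly one block [N n s], so the [j]-th diagonal entry of the product is
    1 if every [q] in [qs] equals [s], and 0 otherwise. The nonempty blocks form a partition once
    [r <= n]. *)
Lemma tau_blockD_word (qs : seq 'I_r) n : (r <= n)%N ->
  tau P (fun=> \prod_(q <- qs) blockD (N n q) : 'M[C]_n) =
  \sum_s (#|N n s|%:R / n%:R : R)%:C%C * \prod_(q <- qs) (q == s)%:R.
Proof.
move=> le; have [_ dis cov _] := hN le.
have -> : \prod_(q <- qs) blockD (N n q) =
    diag_mx (\row_j \prod_(q <- qs) (j \in N n q)%:R) :> 'M[C]_n.
  elim: qs => [|q qs IH].
    by rewrite big_nil; apply/matrixP => i j; rewrite !mxE big_nil.
  rewrite big_cons IH -[_ * diag_mx _]/(_ *m _) mulmx_diag; congr diag_mx.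
  by apply/rowP => j; rewrite !mxE big_cons.
have one j s : j \in N n s -> forall q, (j \in N n q) = (q == s).
  move=> js q; apply/idP/eqP => [jq|->//]; apply/eqP/negPn/negP => /dis E.
  by have := finset.in_set0 j; rewrite -E finset.inE jq js.
rewrite /tau cexpectation_cst mxtrace_diag.
under eq_bigr => j _.
  rewrite mxE.
  have -> : \prod_(q <- qs) (j \in N n q)%:R =
     \sum_s (j \in N n s)%:R * \prod_(q <- qs) (q == s)%:R :> C.
    have [s js] := cov j; rewrite (bigD1 s)//= js mul1r [X in _ + X]big1 ?addr0.
      by apply: eq_bigr => q _; rewrite (one j s).
    by move=> s' /negbTE ns; rewrite (one j s)// ns mul0r.
  over.
rewrite exchange_big mulr_sumr; apply: eq_bigr => s _ /=.
rewrite -mulr_suml mulrA; congr (_ * _).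
rewrite fmorph_div !rmorph_nat mulrC; congr (_ / _).
by rewrite -natr_sum -sum1_card [in RHS]big_mkcond.
Qed.

Lemma tau_blockD_word_cvg (qs : seq 'I_r) :
  ccvg (fun n => tau P (fun=> \prod_(q <- qs) blockD (N n q) : 'M[C]_n))
       (\sum_s (d s)%:C%C * \prod_(q <- qs) (q == s)%:R).
Proof.
apply: (@ccvg_eventually _ r (fun n =>
  \sum_s (#|N n s|%:R / n%:R : R)%:C%C * \prod_(q <- qs) (q == s)%:R)).
  by move=> n /tau_blockD_word ->.
apply: ccvg_sum => s; apply: ccvg_mul; last exact: ccvg_cst.
exact: (ccvg_real (@hd s)).
Qed.

(** The trace of the identity matrix, seen as the empty word, has limit [phi 1 = 1] in the free
    model and the sum of the [d q] by counting the blocks. *)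
Lemma sum_d : \sum_q d q = 1.
Proof.
have h1 : ccvg (fun n => tau P (fun=> 1 : 'M[C]_n)) 1.
  have := @word_cvg [::]; rewrite big_nil phi1; congr ccvg.
  by apply/funext => n; congr tau; apply/funext => x; rewrite big_nil.
have h2 := @tau_blockD_word_cvg [::].
have h3 : ccvg (fun n => tau P (fun=> 1 : 'M[C]_n)) ((\sum_q d q)%:C)%C.
  move: h2; congr ccvg.
    by apply/funext => n; congr tau; apply/funext => x; rewrite big_nil.
  by rewrite rmorph_sum; apply: eq_bigr => q _; rewrite big_nil mulr1.
by have /(congr1 (@complex.Re R)) := ccvg_unique h3 h1.
Qed.

(** Both sides are limits of the same matrix moments. The truncated [gamma] of the assumption is
    replaced by [full_gamma], which does not depend on the length of the word. *)
Lemma word_moment_Y (w : seq letter) : all (fun l => is_inl l) w ->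
  phi (\prod_(l <- w) alg_letter l) = Psi d (ocomp (map op_letter w)).
Proof.
move=> hw; have [us ->] : exists us, w = map inl us.
  elim: w hw => [|[u|//] w IH] /= hw; first by exists [::].
  by have [us ->] := IH hw; exists (u :: us).
apply: ccvg_unique (@word_cvg _) _.
have := @hYlim _ (tnth (in_tuple us)); congr ccvg.
  apply/funext => n; congr tau; apply/funext => x.
  by rewrite big_map big_tnth.
rewrite !PsiE; apply: eq_bigr => q _; rewrite op_prod_gamma.
by rewrite /ocomp !big_map [in RHS]big_tnth.
Qed.

Lemma word_moment_D (w : seq letter) : all (fun l => ~~ is_inl l) w ->
  phi (\prod_(l <- w) alg_letter l) = Psi d (ocomp (map op_letter w)).
Proof.
move=> hw; have [qs ->] : exists qs, w = map inr qs.
  elim: w hw => [|[//|q] w IH] /= hw; first by exists [::].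
  by have [qs ->] := IH hw; exists (q :: qs).
apply: ccvg_unique (@word_cvg _) _.
have := @tau_blockD_word_cvg qs; congr ccvg.
  by apply/funext => n; congr tau; apply/funext => x; rewrite big_map.
rewrite PsiE; apply: eq_bigr => s _; congr (_ * _).
suff E x b : ocomp (map op_letter (map inr qs)) x b =
    \prod_(q <- qs) (q == first_index b)%:R * x b.
  by rewrite E /vacuum /ket eqxx mulr1.
elim: qs => [|q qs IH]; first by rewrite /ocomp /= !big_nil mul1r.
rewrite /= ocomp_cons /= {1}/Defs.proj big_cons eq_sym.
by case: eqP => _; rewrite ?mul1r ?mul0r.
Qed.

(** The two elements come from one polynomial in letters of a single kind, [true] for the [Y u] and
    [false] for the blocks. Using a relation avoids having to show that a map between the two
    algebras is well defined. *)
Let corresp b a T := exists X, gen_triple (fun l => is_inl l == b) X a T.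

Lemma corresp_in_class b a T : corresp b a T -> in_class d b T.
Proof.
case=> X; elim=> {X a T} [|l /eqP|c X1 X2 a1 a2 T1 T2 _ h1 _ h2
    |X1 X2 a1 a2 T1 T2 _ h1 _ h2].
- by case: b; [exact: shift_op_id | exact: diag_op_id].
- case: l => [u|q] /= <-; first exact: (shift_op_full_gamma _ hd0 sum_d).
  exact: diag_op_proj.
- by case: b h1 h2; [exact: shift_op_lin | exact: diag_op_lin].
- by case: b h1 h2; [exact: shift_op_comp | exact: diag_op_comp].
Qed.

Lemma corresp_gen_subalg b a T : corresp b a T ->
  gen_subalg (if b then range y else range z) a.
Proof.
case=> X; elim=> {X a T} [|l /eqP|c X1 X2 a1 a2 T1 T2 _ h1 _ h2
    |X1 X2 a1 a2 T1 T2 _ h1 _ h2].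
- exact: gen_one.
- by case: l => [u|q] /= <-; apply: gen_base; [exists u | exists q].
- exact: gen_lin.
- exact: gen_mul.
Qed.

Lemma corresp_free (s : seq (bool * (A * op))) : s != [::] ->
  all (fun t => `[< corresp t.1 t.2.1 t.2.2 /\ phi t.2.1 = 0 >]) s ->
  sorted (fun b b' => b != b') (map fst s) ->
  phi (\prod_(t <- s) t.2.1) = 0.
Proof.
(* The default value only fills positions beyond the list, which the freeness condition does not
   read. *)
move=> s0 /(all_nthP (true, (1, id))) cs /(sortedP true) alt.
rewrite (big_nth (true, (1, id))) big_mkord.
apply: (hfree (i := fun k => nth true (map fst s) k)
              (a := fun k => (nth (true, (1, id)) s k).2.1)).
- by case: (s) s0.
- move=> k lt; rewrite (nth_map (true, (1, id)))//.
  have /asboolP[c p0] := cs k lt; split=> //.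
  exact: corresp_gen_subalg c.
- by move=> k lt; apply/eqP/alt; rewrite size_map.
Qed.

(** A word is a product with one factor per letter, each lying in one of the two subalgebras, so
    agreement of the marginal moments together with freeness gives agreement here. *)
Lemma word_moment (w : seq letter) :
  phi (\prod_(l <- w) alg_letter l) = Psi d (ocomp (map op_letter w)).
Proof.
have := @free_moments_agree _ _ _ d hd0 sum_d _ phi corresp _ _ _ _ _ _ _
  [seq (is_inl l, (alg_letter l, op_letter l)) | l <- w].
rewrite big_map /= -map_comp; apply.
- by move=> b; eexists; exact: gen_triple_one.
- by move=> b c a a' T T' [X h] [X' h']; eexists; exact: gen_triple_lin h h'.
- by move=> b a a' T T' [X h] [X' h']; eexists; exact: gen_triple_mul h h'.
- move=> [] a T [X /gen_triple_word_triple]; apply: word_triple_moment => v.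
    by move=> hv; apply: word_moment_Y; apply: sub_all hv => l /eqP.
  by move=> hv; apply: word_moment_D; apply: sub_all hv => l /eqP ->.
- exact: corresp_in_class.
- by move=> b a T [X]; exact: lin_op_gen_triple.
- exact: corresp_free.
- rewrite all_map; apply/allP => l _; apply/asboolP.
  by eexists; exact: gen_triple_letter.
Qed.

(** * Moments of the symmetric blocks *)

Lemma gen_triple_symblock p q u : exists a, gen_triple predT
  (fun n x => symblock (N n) p q (Y u n x)) a (full_gamma_hat d kappa p q u).
Proof.
have sand p' q' : exists a, gen_triple predT
    (fun n x => blockD (N n p') *m Y u n x *m blockD (N n q')) a
    (sandwich p' q' (full_gamma d kappa u)).
  eexists.
  exact: (gen_triple_mul (gen_triple_mul (@gen_triple_letter predT (inr p') isT)
    (@gen_triple_letter predT (inl u) isT))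
    (@gen_triple_letter predT (inr q') isT)).
rewrite /symblock /full_gamma_hat; case: eqP => _; first exact: sand.
have [a1 h1] := sand p q; have [a2 h2] := sand q p.
eexists; have := gen_triple_lin 1 h1 h2; congr gen_triple.
  by apply: mats_ext => n x; rewrite scale1r.
by apply/funext => x; apply/funext => b; rewrite /op_add /op_scale mul1r.
Qed.

Lemma gen_triple_symblock_prod m (p q : 'I_m -> 'I_r) (u : 'I_m -> U) :
  exists a, gen_triple predT
    (fun n x => \prod_(k < m) symblock (N n) (p k) (q k) (Y (u k) n x)) a
    (op_prod (fun k => full_gamma_hat d kappa (p k) (q k) (u k))).
Proof.
elim: m p q u => [|m IH] p q u.
  eexists; have := @gen_triple_one predT; rewrite /op_prod big_ord0.
  by congr gen_triple; apply: mats_ext => n x; rewrite big_ord0.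
have [a1 h1] := gen_triple_symblock (p ord0) (q ord0) (u ord0).
have [a2 h2] := IH (p \o lift ord0) (q \o lift ord0) (u \o lift ord0).
eexists; have := gen_triple_mul h1 h2; rewrite /op_prod big_ord_recl.
congr gen_triple.
by apply: mats_ext => n x; rewrite big_ord_recl.
Qed.

(** The partial trace is [tau] of the product with the block of [q0], divided by the proportion of
    that block. Both converge, and the proportion has the nonzero limit [d q0]. *)
Lemma symblock_moments m (p q : 'I_m -> 'I_r) (u : 'I_m -> U) q0 (hq0 : 0 < d q0) :
  ccvg (fun n => ptau P (N n q0)
          (fun x => \prod_(k < m) symblock (N n) (p k) (q k) (Y (u k) n x)))
       (Psi_at q0 (op_prod (fun k => gamma_hat d kappa m (p k) (q k) (u k)))).
Proof.
have [a h] := gen_triple_symblock_prod p q u.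
have [L _] := word_triple_cvg (gen_triple_word_triple h).
have h' := gen_triple_mul (@gen_triple_letter predT (inr q0) isT) h.
have [_ cv] := word_triple_cvg (gen_triple_word_triple h').
apply: (@ccvg_eventually _ 1 (fun n => (#|N n q0|%:R / n%:R : R)%:C%C^-1 *
  tau P (fun x => blockD (N n q0) *
    \prod_(k < m) symblock (N n) (p k) (q k) (Y (u k) n x)))).
  by move=> n n0; rewrite ptau_blockD.
have dq0 : (d q0)%:C%C != 0 :> C.
  by rewrite -(rmorph0 (real_complex R)) (inj_eq (@complexI R)) gt_eqF.
have -> : Psi_at q0 (op_prod (fun k => gamma_hat d kappa m (p k) (q k) (u k))) =
    ((d q0)%:C%C)^-1 * phi (z q0 * a).
  have -> : phi (z q0 * a) = Psi d (Defs.proj q0 \o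
      op_prod (fun k => full_gamma_hat d kappa (p k) (q k) (u k))).
    by apply: (word_triple_moment _ (gen_triple_word_triple h')) => w _; exact: word_moment.
  (* The projection removes every vacuum coordinate except that of [q0], leaving [d q0] times the
     state at [q0]. *)
  rewrite PsiE (bigD1 q0)//= [X in _ + X]big1 ?addr0 => [|s /negbTE ns].
    by rewrite {1}/Defs.proj eqxx mulrA mulVf// mul1r Psi_atE op_prod_gamma_hat.
  by rewrite {1}/Defs.proj /first_index /= ns mulr0.
exact: (ccvg_mul (ccvg_inv dq0 (ccvg_real (@hd q0))) cv).
Qed.

End MixedMoments.

Theorem theorem6p1 (R : realType) (disp : measure_display)
    (Omega : measurableType disp) (P : probability Omega R)
    (r : nat) (U : finType)
    (N : forall n : nat, 'I_r -> {set 'I_n}) (d : 'I_r -> R)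
    (hN : forall n, (r <= n)%N -> interval_partition (N n))
    (hd : forall q, (fun n => #|N n q|%:R / n%:R : R) @ \oo --> d q)
    (hd0 : forall q, 0 <= d q)
    (kappa : U -> nat -> R)
    (Y : U -> forall n : nat, Omega -> 'M[R[i]]_n)
    (hYL : forall u n i j, in_Linfty_minus P (fun x => Y u n x i j))
    (hYind : forall n, independent_mx P (fun u => Y u n))
    (hYherm : forall u n, {ae P, forall x, hermitian_mx (Y u n x)})
    (hYlim : forall (m : nat) (u : 'I_m -> U),
        ccvg (fun n => tau P (fun x => \prod_(k < m) Y (u k) n x))
             (Psi d (op_prod (fun k => gamma d kappa m (u k)))))
    (hYfree : asymptotically_free P Y (fun q n _ => blockD (N n q)))
    (C : R) (hYC : forall u n, {ae P, forall x, opnorm (Y u n x) <= C})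
    (m : nat) (u : 'I_m -> U) (p q : 'I_m -> 'I_r) (q0 : 'I_r)
    (hq0 : 0 < d q0) :
  ccvg (fun n => ptau P (N n q0)
          (fun x => \prod_(k < m) symblock (N n) (p k) (q k) (Y (u k) n x)))
       (Psi_at q0 (op_prod (fun k => gamma_hat d kappa m (p k) (q k) (u k)))).
Proof.
case: hYfree => A [phi] [y] [z] [phi1 hfree hjoint].
exact: (symblock_moments hN hd hd0 hYL hYlim phi1 hfree hjoint).
Qed.
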